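(* Let $a>0$ be a fixed real number. Let $(k_n,n\ge1)$ be a sequence of integers with $1\le k_n\le n$ for all $n$ and $\lim_{n\to\infty}k_n/n=1$, and let $\mathbb{X}=(X_n,n\ge 1)$ be a strictly stationary sequence of random variables on a probability space $(\Omega,\mathcal{F},\mathbb{P})$ such that $\gamma_1(X_1|\mathcal{I}^{\mathbb{X}})=\infty$ almost surely. Then $$\frac{S(k_n,n,a)}{X_{k_n:n}}\sim K(k_n,n,a)\quad\text{almost surely as } n\to\infty.$$ If moreover $(N(t),t\ge0)$ is a process of non-negative integer-valued random variables on $(\Omega,\mathcal{F},\mathbb{P})$ such that $N(t)\to\infty$ almost surely as $t\to\infty$, then $$\frac{\mathcal{S}_t(k_{N(t)},a)}{X_{k_{N(t)}:N(t)}}\sim\mathcal{K}_t(k_{N(t)},a)\quad\text{almost surely as } t\to\infty.$$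
   Context: $\mathcal{I}^{\mathbb{X}}$ is the sigma-field of sets invariant with respect to $\mathbb{X}$, i.e. of all $A\subseteq\Omega$ for which there is a Borel set $B\in\mathcal{B}(\mathbb{R}^{\mathbb{N}})$ with $A=\{\omega\in\Omega:(X_i(\omega),X_{i+1}(\omega),\ldots)\in B\}$ for every $i\ge1$. An extended random variable is a measurable function with values in $[-\infty,\infty]$. For a (real-valued) random variable $X$ on $(\Omega,\mathcal{F},\mathbb{P})$ and a sigma-field $\mathcal{G}\subseteq\mathcal{F}$, the conditional right endpoint of the support of $X$ given $\mathcal{G}$, denoted $\gamma_1(X|\mathcal{G})$, is an extended random variable $\underline{Q}_1$ such that (i) $\underline{Q}_1$ is $\mathcal{G}$-measurable; (ii) $\mathbb{P}(X\le\underline{Q}_1|\mathcal{G})=1$ a.s.; (iii) for any $\mathcal{G}$-measurable extended random variable $Q_1$ with $\mathbb{P}(X\le Q_1|\mathcal{G})=1$ a.s., one has $Q_1\ge\underline{Q}_1$ a.s. It exists and is unique up to almost sure equality. $X_{1:n}\le\cdots\le X_{n:n}$ are the order statistics of $X_1,\ldots,X_n$; $I(\cdot)$ is the indicator function. Define $K(k_n,n,a)=\sum_{i=1}^n I(X_{k_n:n}-a<X_i<X_{k_n:n})$, $S(k_n,n,a)=\sum_{i=1}^n X_i\, I(X_{k_n:n}-a<X_i<X_{k_n:n})$, $\mathcal{K}_t(k_{N(t)},a)=\sum_{i=1}^{N(t)} I(X_{k_{N(t)}:N(t)}-a<X_i<X_{k_{N(t)}:N(t)})$, $\mathcal{S}_t(k_{N(t)},a)=\sum_{i=1}^{N(t)}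 X_i\, I(X_{k_{N(t)}:N(t)}-a<X_i<X_{k_{N(t)}:N(t)})$, with empty sums equal to $0$. Here $f_n\sim g_n$ almost surely as $n\to\infty$ means: almost surely there are numbers $\varepsilon_n\to0$ such that $f_n=(1+\varepsilon_n)g_n$ for all sufficiently large $n$ (equivalently $f_n/g_n\to1$ with the convention $0/0=1$); analogously for $t\to\infty$. The quotients by $X_{k_n:n}$ and $X_{k_{N(t)}:N(t)}$ are assigned the value $0$ when undefined (zero denominator or $N(t)=0$). *)

(* Defs.v *)
From HB Require Import structures.
From mathcomp Require Export all_boot all_order all_algebra.
From mathcomp Require Export all_classical all_reals all_analysis.
(* [all_analysis] does not re-export the measurable structure of [\bar R]. *)
From mathcomp Require Export measurable_realfun.

Set Implicit Arguments.
Unset Strict Implicit.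
Unset Printing Implicit Defensive.

Import Order.TTheory GRing.Theory Num.Theory.
Import numFieldNormedType.Exports.

Local Open Scope classical_set_scope.
Local Open Scope ring_scope.

(* Sequences are indexed from 0: the term [x i] of [x : R^nat], or [X i] of a
   process, is the usual x_{i+1}, X_{i+1}.  Ranks and sample sizes are not
   shifted. *)

(** ** Order statistics and sums of near-order-statistic observations *)

(* x_{k:n}, the k-th smallest of the first n terms (1 <= k <= n); the value is
   0 when n = 0. *)
Definition order_stat {R : realType} (x : R^nat) (k n : nat) : R :=
  nth 0 (sort <=%R (mkseq x n)) k.-1.

Definition in_window {R : realType} (x : R^nat) (k n : nat) (a : R)
    (i : nat) : bool :=
  order_stat x k n - a < x i < order_stat x k n.

Definition Kcount {R : realType} (x : R^nat) (k n : nat) (a : R) : R :=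
  \sum_(i < n) (in_window x k n a i)%:R.

Definition Ssum {R : realType} (x : R^nat) (k n : nat) (a : R) : R :=
  \sum_(i < n) x i * (in_window x k n a i)%:R.

(* The zeros of [g] are allowed: at such points [f] must vanish too (eventually),
   which amounts to f / g --> 1 with the convention 0 / 0 = 1. *)
Definition asymp_equiv {R : realType} {I : Type} (F : set_system I)
    (f g : I -> R) : Prop :=
  exists2 eps : I -> R,
    eps i @[i --> F] --> (0 : R) & \forall i \near F, f i = (1 + eps i) * g i.

(** ** Stationary sequences and invariant sets *)

(* The Borel sigma-field of R^N (which is the product sigma-field). *)
Definition borel_seq (R : realType) : set (set R^nat) :=
  <<s \bigcup_i preimage_set_system setT (fun x : R^nat => x i) measurable >>.

Section process.
Context {d : measure_display} {T : measurableType d} {R : realType}.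
Context {P : probability T R}.
Implicit Type X : nat -> {RV P >-> R}.

Definition tail_path X (i : nat) (w : T) : R^nat := fun j => X (i + j)%N w.

Definition sample_path X (w : T) : R^nat := fun j => X j w.

Definition strictly_stationary X : Prop :=
  forall (h : nat) (B : set R^nat), borel_seq B ->
    P (tail_path X h @^-1` B) = P (sample_path X @^-1` B).

Definition invariant_sets X : set (set T) :=
  [set A | exists2 B : set R^nat, borel_seq B &
             forall i, A = tail_path X i @^-1` B].

End process.

(** ** Conditional probability and conditional right endpoint *)

Section conditional.
Context {d : measure_display} {T : measurableType d} {R : realType}.
Variable P : probability T R.
Variable G : set (set T).

Definition measurable_wrt {d' : measure_display} {U : measurableType d'}
    (f : T -> U) : Prop :=
  forall B : set U, measurable B -> G (f @^-1` B).

(* [g] is a version of P(A | G). *)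
Definition is_cond_prob (A : set T) (g : T -> R) : Prop :=
  [/\ measurable_wrt g,
      P.-integrable setT (EFin \o g) &
      forall C, G C -> (\int[P]_(w in C) (g w)%:E = P (A `&` C))%E].

Definition cond_prob_eq1 (A : set T) : Prop :=
  exists2 g : T -> R, is_cond_prob A g & {ae P, forall w, g w = 1}.

(* [Q] is a version of gamma_1(X | G). *)
Definition is_cond_right_endpoint (X : {RV P >-> R}) (Q : T -> \bar R) : Prop :=
  [/\ measurable_wrt Q,
      cond_prob_eq1 [set w | ((X w)%:E <= Q w)%E] &
      forall Q' : T -> \bar R, measurable_wrt Q' ->
        cond_prob_eq1 [set w | ((X w)%:E <= Q' w)%E] ->
        {ae P, forall w, (Q w <= Q' w)%E}].

End conditional.

(** ** The invariant sets form a sub-sigma-field *)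

Lemma measurable_tail_path {d : measure_display} {T : measurableType d}
    {R : realType} {P : probability T R} (X : nat -> {RV P >-> R}) (i : nat)
    (B : set R^nat) :
  borel_seq B -> measurable (tail_path X i @^-1` B).
Proof.
pose H := [set B : set R^nat | measurable (tail_path X i @^-1` B)].
suff : @borel_seq R `<=` H by exact.
apply: smallest_sub => [|A [j _ [C mC <-]]].
- split=> [|A mA|A mA]; rewrite /H /=.
  + by rewrite preimage_set0.
  + by rewrite setTD -preimage_setC; exact: measurableC.
  + by rewrite preimage_bigcup; exact: bigcupT_measurable.
- rewrite /H /= setTI -[X in measurable X]setTI.
  exact: (measurable_funPT (X (i + j)%N)).
Qed.

Lemma invariant_sets_measurable {d : measure_display} {T : measurableType d}
    {R : realType} {P : probability T R} (X : nat -> {RV P >-> R}) :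
  invariant_sets X `<=` measurable.
Proof. by move=> A [B bB /(_ 0%N) ->]; exact: measurable_tail_path. Qed.

Lemma sigma_algebra_invariant_sets {d : measure_display} {T : measurableType d}
    {R : realType} {P : probability T R} (X : nat -> {RV P >-> R}) :
  sigma_algebra setT (invariant_sets X).
Proof.
split.
- by exists set0; [exact: sigma_algebra0|move=> i; rewrite preimage_set0].
- move=> A [B bB AB]; exists (setT `\` B); first exact: sigma_algebraCD.
  by move=> i; rewrite !setTD -preimage_setC -AB.
- move=> A iA.
  have /choice [B hB] : forall n, exists B : set R^nat,
      borel_seq B /\ forall i, A n = tail_path X i @^-1` B.
    by move=> n; have [B ? ?] := iA n; exists B.
  exists (\bigcup_n B n).
    by apply: sigma_algebra_bigcup => n; have [] := hB n.
  move=> i; rewrite preimage_bigcup; apply: eq_bigcupr => n _.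
  by have [_] := hB n; exact.
Qed.

(* Main.v *)
Require Import Defs.
From HB Require Import structures.
From mathcomp Require Import zify lra.
Import Order.TTheory GRing.Theory Num.Theory.
Import numFieldNormedType.Exports.
Local Open Scope classical_set_scope.
Local Open Scope ring_scope.

(** Write M_n for the order statistic X_{k_n:n}.  Every observation counted by
    K(k_n, n, a) lies in ]M_n - a, M_n[, so as soon as M_n > 0 one has
    |S / M_n - K| <= (a / M_n) K, and the claim follows from M_n --> +oo
    ([asymp_equiv_window]).  As k_n / n --> 1, the order statistic exceeds a
    level u once the proportion of observations above u is bounded away from 0
    ([order_stat_cvg_pinfty]).  It therefore suffices that, almost surely, for
    every integer u, the frequency of exceedances of u has positive lower
    limit.

    The ergodic theorem would identify this frequency with P(X_1 > u | I), but
    only its positivity matters, and a maximal inequality is enough.  The paths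
    whose lower frequency of exceedances of u is 0 form an invariant set A
    ([rare_invariant_sets]).  Let 1_j be the indicator of the event that the
    j-th observation exceeds u, and let G_n be the maximum of 0 and of the first
    n partial sums of the variables 1 - q 1_j.  Garsia's argument compares G_n
    along the path with G_n along the shifted path ([garsia_ineq]);
    integrating over A, where by stationarity and invariance both have the same
    integral, yields q P(A, X_1 > u, G_n > 0) <= 1 ([maximal_rare]).  On A some
    G_n is positive whatever q is, so P(A, X_1 > u) = 0 ([exceed_rare_null]).
    Hence the variable equal to u on A and to +oo elsewhere is an invariant
    upper bound of X_1, and minimality of the conditional right endpoint, which
    is +oo, forces P(A) = 0 ([not_rare_ae]).

    The statement for a random sample size is the same pathwise equivalence
    composed with t |-> N(t) ([asymp_equiv_comp]). *)

(** * Exceedances of a level along a deterministic sequence *)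

Definition exceedances {R : realType} (u : R) (x : R^nat) (n : nat) : nat :=
  \sum_(j < n) (u < x j)%R.

(** The lower limit of the frequency of exceedances is zero.  This integer form,
    with an additive slack [D], makes invariance under the shift immediate:
    dropping the first term changes the count by at most one. *)
Definition rare {R : realType} (u : R) : set R^nat :=
  [set x | forall q D, exists n, (q * exceedances u x n + D < n)%N].

(** The maximum of 0 and of the first [n] partial sums of the sequence
    1 - q * (u < x j): truncated subtraction takes care of the maximum with 0,
    and keeps the values in [nat]. *)
Definition garsia_max {R : realType} (u : R) (q n : nat) (x : R^nat) : nat :=
  \max_(j < n.+1) (j - q * exceedances u x j).

Lemma exceedances_shift {R : realType} (u : R) (x : R^nat) n :
  exceedances u x n.+1
  = ((u < x 0%N)%R + exceedances u (fun j => x j.+1) n)%N.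
Proof. by rewrite /exceedances big_ord_recl. Qed.

Lemma garsia_max_le {R : realType} (u : R) q n (x : R^nat) :
  (garsia_max u q n x <= n)%N.
Proof.
by apply/bigmax_leqP => j _; rewrite (leq_trans (leq_subr _ _))// -ltnS.
Qed.

Lemma leq_garsia_max {R : realType} (u : R) q n (x : R^nat) j : (j <= n)%N ->
  (j - q * exceedances u x j <= garsia_max u q n x)%N.
Proof.
move=> jn.
exact: (leq_bigmax (F := fun j : 'I_n.+1 => j - q * exceedances u x j)%N
  (Ordinal (jn : (j < n.+1)%N))).
Qed.

(** Garsia's inequality: if the maximum is positive it is attained by a nonempty
    partial sum, which is its first term 1 - q * (u < x 0) plus a partial sum of
    the shifted sequence. *)
Lemma garsia_ineq {R : realType} (u : R) q n (x : R^nat) :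
  (garsia_max u q n x + q * ((0 < garsia_max u q n x) && (u < x 0%N)%R)
   <= 1 + garsia_max u q n (fun j => x j.+1))%N.
Proof.
have [->|M0] := posnP (garsia_max u q n x); first by rewrite muln0.
have [j Mj] : {j : 'I_n.+1 |
    garsia_max u q n x = (j - q * exceedances u x j)%N}.
  by apply: bigop.eq_bigmax; rewrite card_ord.
case: j Mj => -[|j] /= jn Mj; first by rewrite Mj in M0.
have := @leq_garsia_max _ u q n (fun j => x j.+1) j (ltnW jn).
move: M0; rewrite Mj exceedances_shift; case: (u < _)%R => /=; lia.
Qed.

Lemma rare_shift {R : realType} (u : R) (x : R^nat) :
  rare u (fun j => x j.+1) <-> rare u x.
Proof.
split=> + q D.
- move=> /(_ q (q + D)%N) [n qn]; exists n.+1; rewrite exceedances_shift.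
  by case: (u < _)%R; lia.
- move=> /(_ q D.+1) [[|n]]; first by lia.
  by rewrite exceedances_shift => qn; exists n; lia.
Qed.

(** If the [k]-th smallest value is at most [u], then so are [k] of the [n]
    terms, which leaves at most [n - k] exceedances. *)
Lemma lt_order_stat {R : realType} (u : R) (x : R^nat) (k n : nat) :
  (1 <= k <= n)%N -> (n - k < exceedances u x n)%N -> u < order_stat x k n.
Proof.
move=> /andP[k0 kn]; apply: contraTT; rewrite -leqNgt -leNgt /order_stat => su.
set s := sort _ _ in su.
have ss : size s = n by rewrite size_sort size_mkseq.
have -> : exceedances u x n = count (fun y => u < y) s.
  rewrite /s count_sort /mkseq count_map /exceedances -sum1_count.
  by rewrite [RHS]big_mkcond /=
    -(big_mkord xpredT (fun j => (u < x j)%R : nat)) /index_iota subn0.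
rewrite -[s](cat_take_drop k) count_cat.
have -> : count (fun y => u < y) (take k s) = 0%N.
  apply/eqP; rewrite -leqn0 leqNgt -has_count; apply/hasPn => y.
  move=> /(nthP 0)[i]; rewrite size_takel ?ss// => ik <-.
  rewrite nth_take// -leNgt (le_trans _ su)//.
  apply: (sorted_leq_nth le_trans le_refl 0 (sort_sorted le_total _)).
  - by rewrite inE ss; lia.
  - by rewrite inE ss; lia.
  - by lia.
by rewrite add0n (leq_trans (count_size _ _))// size_drop ss.
Qed.

(** Not being rare bounds the number of exceedances below by a fixed fraction
    of [n], whereas [n - k n] is negligible with respect to [n]. *)
Lemma order_stat_cvg_pinfty {R : realType} (x : R^nat) (k : nat -> nat) :
  (forall n : nat, (1 <= n)%N -> (1 <= k n <= n)%N) ->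
  (k n)%:R / n%:R @[n --> \oo] --> (1 : R) ->
  (forall m : nat, ~ rare m%:R x) ->
  order_stat x (k n) n @[n --> \oo] --> +oo.
Proof.
move=> k_range k_lim nrare; apply/cvgryPge => A.
have [m Am] : exists m : nat, A <= m%:R.
  by eexists; exact/ltW/truncnS_gt.
have : exists q D, forall n, (n <= q * exceedances m%:R x n + D)%N.
  move: (nrare m) => /existsNP[q /existsNP[D /forallNP h]].
  by exists q, D => n; move/negP: (h n); rewrite -leqNgt.
move=> [q [D hc]].
have q0 : (0 < q)%N by move: (hc D.+1); case: q {hc} => //; lia.
(* There are at least (n - D) / q exceedances, hence at least n / (2 q) once
   2 D <= n; so n - k n < n / (2 q) is enough. *)
have e0 : 1 - (2 * q)%:R^-1 < 1 :> R.
  by rewrite gtrBl invr_gt0 ltr0n muln_gt0.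
have kq := cvgr_gt _ k_lim _ e0.
near=> n.
have n0 : (0 < n)%N by near: n; exact: nbhs_infty_gt.
have nD : (2 * D <= n)%N by near: n; exact: nbhs_infty_ge.
have kn : 1 - (2 * q)%:R^-1 < (k n)%:R / n%:R :> R by near: n; exact: kq.
apply/ltW/(le_lt_trans Am)/lt_order_stat; first exact: k_range.
have /andP[_ knn] := k_range _ n0.
rewrite -(ltn_pmul2l q0); move: (hc n) nD; set E := (q * exceedances _ _ _)%N.
suff : (2 * (q * (n - k n)) < n)%N by clear; set F := (q * (n - _))%N; lia.
rewrite mulnA mulnBr ltn_subLR ?leq_mul// addnC.
move: kn; rewrite ltr_pdivlMr ?ltr0n// mulrBl mul1r ltrBlDr => kn.
have : ((2 * q)%:R * n%:R : R) < (2 * q)%:R * ((k n)%:R + (2 * q)%:R^-1 * n%:R).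
  by rewrite ltr_pM2l// ltr0n muln_gt0.
rewrite mulrDr mulVKf ?pnatr_eq0 -?lt0n ?muln_gt0// -!natrM -natrD ltr_nat.
by rewrite addnC.
Unshelve. all: by end_near. Qed.

(** * Asymptotic equivalence for the window sums *)

(** The terms in the window are within [a] of the order statistic, so that the
    relative error of the equivalence is at most [a] divided by it. *)
Lemma asymp_equiv_window {R : realType} (x : R^nat) (k : nat -> nat) (a : R) :
  0 < a -> order_stat x (k n) n @[n --> \oo] --> +oo ->
  asymp_equiv \oo (fun n => Ssum x (k n) n a / order_stat x (k n) n)
                  (fun n => Kcount x (k n) n a).
Proof.
move=> a0 Moo; pose M n := order_stat x (k n) n.
pose f n := Ssum x (k n) n a / M n; pose K n := Kcount x (k n) n a.
have K0 n : 0 <= K n by exact: sumr_ge0.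
have fK n : 0 < M n -> `|f n - K n| <= a / M n * K n.
  move=> M0; rewrite /f /K /Ssum /Kcount mulr_suml -sumrB mulr_sumr.
  apply: le_trans (ler_norm_sum _ _ _) _; apply: ler_sum => i _.
  have [|] := boolP (in_window x (k n) n a i); last first.
    by rewrite !mulr0 mul0r subrr normr0.
  rewrite /in_window -/(M n) => /andP[l r]; rewrite !mulr1.
  have -> : x i / M n - 1 = (x i - M n) / M n.
    by rewrite mulrBl divff// gt_eqF.
  rewrite normrM normfV (gtr0_norm M0) ler_pM2r ?invr_gt0// ler_norml.
  by apply/andP; split; lra.
have M0 : \forall n \near \oo, 0 < M n by move/cvgryPgt : Moo; exact.
(* When K n = 0, this error is 0 and the bound fK gives f n = 0. *)
exists (fun n => (f n - K n) / K n); last first.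
  near=> n; have Mn : 0 < M n by near: n; exact: M0.
  rewrite -/(f n) -/(K n).
  have [Kn|Kn] := eqVneq (K n) 0; last by rewrite mulrDl mul1r divfK// subrKC.
  by have := fK n Mn; rewrite Kn !mulr0 subr0 normr_le0 => /eqP.
have aM : a / M n @[n --> \oo] --> (0 : R).
  rewrite -[X in _ --> X](mulr0 a); apply: cvgM; first exact: cvg_cst.
  by apply/gtr0_cvgV0.
apply/cvgr0Pnorm_le => // e e0; near=> n.
have Mn : 0 < M n by near: n; exact: M0.
apply: (@le_trans _ _ (a / M n)); last first.
  rewrite (le_trans (ler_norm _))//; near: n.
  by move/cvgr0Pnorm_le : aM; exact.
have [Kn|Kn] := eqVneq (K n) 0.
  by rewrite Kn invr0 mulr0 normr0 divr_ge0// ltW.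
have Kp : 0 < K n by rewrite lt0r Kn K0.
by rewrite normrM normfV (gtr0_norm Kp) ler_pdivrMr// fK.
Unshelve. all: by end_near. Qed.

Lemma asymp_equiv_comp {R : realType} {I J : Type} (F : set_system I)
    (G : set_system J) (f g : I -> R) (h : J -> I) :
  h @ G --> F -> asymp_equiv F f g -> asymp_equiv G (f \o h) (g \o h).
Proof.
move=> hGF [eps eps0 fg]; exists (eps \o h); first exact: cvg_comp hGF eps0.
exact: (hGF _ fg).
Qed.

(** * Measurability on the path space *)

(** The sequences equipped with the sigma-field [borel_seq], so that path
    functionals can be integrated against the law of the process. *)
Definition path_space (R : realType) := g_sigma_algebraType
  (\bigcup_i preimage_set_system setT (fun x : R^nat => x i) measurable).

HB.instance Definition _ (R : realType) := Measurable.on (path_space R).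

Lemma measurable_path {d : measure_display} {T : measurableType d}
    {R : realType} {P : probability T R} (X : nat -> {RV P >-> R}) (i : nat) :
  measurable_fun setT (tail_path X i : T -> path_space R).
Proof. by move=> _ B mB; rewrite setTI; exact: measurable_tail_path. Qed.

Lemma measurable_pred {d : measure_display} {T : measurableType d}
    (b : T -> bool) : measurable_fun setT b -> measurable [set x | b x].
Proof. by move=> /(_ measurableT [set true] I); rewrite setTI. Qed.

Lemma measurable_coord {R : realType} (j : nat) :
  measurable_fun setT (fun x : path_space R => x j : R).
Proof.
by move=> _ B mB; apply: sub_sigma_algebra; exists j => //; exists B.
Qed.

Lemma measurable_exceed {R : realType} (u : R) (j : nat) :
  measurable_fun setT (fun x : path_space R => u < x j).
Proof. by apply: measurable_fun_ltr => //; exact: measurable_coord. Qed.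

Lemma measurable_exceedances {R : realType} (u : R) (n : nat) :
  measurable_fun setT (fun x : path_space R => exceedances u x n).
Proof.
elim: n => [|n IH].
  by apply: (eq_measurable_fun (cst 0%N)) => // x _; rewrite /exceedances big_ord0.
apply: (eq_measurable_fun (fun x : path_space R =>
    exceedances u x n + (u < x n)%R)%N).
  by move=> x _; rewrite /exceedances big_ord_recr.
apply: measurable_fun_addn => //.
apply: (measurableT_comp (f := nat_of_bool)) => //.
exact: measurable_exceed.
Qed.

Lemma measurable_garsia_max {R : realType} (u : R) (q n : nat) :
  measurable_fun setT (fun x : path_space R => garsia_max u q n x).
Proof.
have mt j : measurable_fun setT
    (fun x : path_space R => (j - q * exceedances u x j)%N).
  apply: (measurableT_comp (f := fun c => (j - q * c)%N)) => //.
  exact: measurable_exceedances.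
elim: n => [|n IH].
  apply: (eq_measurable_fun (fun x : path_space R =>
    0 - q * exceedances u x 0)%N) => // x _.
  by rewrite /garsia_max big_ord1.
apply: (eq_measurable_fun (fun x : path_space R =>
    maxn (garsia_max u q n x) (n.+1 - q * exceedances u x n.+1))%N).
  by move=> x _; rewrite /garsia_max [RHS]big_ord_recr.
exact: measurable_fun_maxn.
Qed.

Lemma borel_rare {R : realType} (u : R) : borel_seq (rare u).
Proof.
suff : measurable (rare u : set (path_space R)) by [].
rewrite (_ : rare u = \bigcap_q \bigcap_D \bigcup_n
    [set x : path_space R | q * exceedances u x n + D < n]%N); last first.
  apply/seteqP; split=> x.
    by move=> + q _ D _ => /(_ q D)[n]; exists n.
  by move=> + q D => /(_ q I D I)[n _]; exists n.
apply: bigcapT_measurable => q; apply: bigcapT_measurable => D.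
apply: bigcupT_measurable => n.
apply: measurable_pred; apply: (measurable_fun_ltn (g := cst n)) => //.
apply: (measurableT_comp (f := fun c => (q * c + D)%N)) => //.
exact: measurable_exceedances.
Qed.

(** * The maximal inequality for a stationary process *)

Section stationary.
Context {d : measure_display} {T : measurableType d} {R : realType}.
Context {P : probability T R} (X : nat -> {RV P >-> R}).

Lemma tail_path0 : tail_path X 0 = sample_path X.
Proof. by []. Qed.

Lemma tail_pathS i w :
  tail_path X i.+1 w = (fun j => tail_path X i w j.+1).
Proof. by apply/funext => j; rewrite /tail_path addSnnS. Qed.

Lemma rare_invariant (u : R) i :
  tail_path X i @^-1` rare u = sample_path X @^-1` rare u.
Proof.
rewrite -tail_path0; elim: i => // i <-; apply/seteqP.
split=> w; rewrite /= tail_pathS.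
  exact: (rare_shift _ _).1.
exact: (rare_shift _ _).2.
Qed.

Lemma rare_invariant_sets (u : R) :
  invariant_sets X (sample_path X @^-1` rare u).
Proof. by exists (rare u); [exact: borel_rare|move=> i; rewrite rare_invariant]. Qed.

Hypothesis X_stat : strictly_stationary X.

(** The sample path and its shifts have the same law. *)
Lemma stationary_integral (B : set (path_space R)) (f : path_space R -> \bar R)
    (i : nat) :
  measurable B -> measurable_fun setT f -> (forall x, 0 <= f x)%E ->
  (\int[P]_(w in tail_path X i @^-1` B) f (tail_path X i w)
   = \int[P]_(w in sample_path X @^-1` B) f (sample_path X w))%E.
Proof.
move=> mB mf f0.
have mX i' := measurable_path X i'.
have := @ge0_integral_pushforward _ _ _ _ _ _ (mX i) P B f mB.
move=> <-//; last exact: measurable_funTS.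
have := @ge0_integral_pushforward _ _ _ _ _ _ (mX 0%N) P B f mB.
move=> <-//; last exact: measurable_funTS.
by apply: eq_measure_integral => A mA AB; exact: X_stat.
Qed.

(** Integrate [garsia_ineq] over the invariant event: by stationarity the
    integrals of the two Garsia maxima coincide, and being bounded by [n] they
    cancel. *)
Lemma maximal_rare (u : R) (q n : nat) :
  (q%:R%:E * P (sample_path X @^-1`
     (rare u `&` [set x | (0 < garsia_max u q n x)%N && (u < x 0%N)%R])) <= 1)%E.
Proof.
set E := [set x | _]; set A := sample_path X @^-1` rare u.
have mA : measurable A := invariant_sets_measurable (rare_invariant_sets u).
have mE : measurable (E : set (path_space R)).
  apply: measurable_pred; apply: measurable_and.
    apply: (measurable_fun_ltn (f := cst 0%N)) => //.
    exact: measurable_garsia_max.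
  exact: measurable_exceed.
have mXE : measurable (sample_path X @^-1` E) by exact: measurable_tail_path 0%N _ mE.
pose M x : \bar R := (garsia_max u q n x)%:R%:E.
have mM : measurable_fun setT (M : path_space R -> _).
  apply: (measurableT_comp (f := fun c : nat => (c%:R : R)%:E)) => //.
  exact: measurable_garsia_max.
have M0 x : (0 <= M x)%E by rewrite lee_fin.
pose I := (\int[P]_(w in A) M (sample_path X w))%E.
have Ifin : I \is a fin_num.
  rewrite ge0_fin_numE; last exact: integral_ge0.
  apply: (@le_lt_trans _ _ (\int[P]_(w in A) cst n%:R%:E w)%E).
    apply: ge0_le_integral => //.
    - by apply: measurable_funTS; exact: (measurableT_comp mM (measurable_path X 0)).
    - by move=> w _; rewrite lee_fin ler_nat garsia_max_le.
  rewrite integral_cst//; apply: le_lt_trans (ltry n%:R).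
  by rewrite -[leRHS]mule1 lee_wpmul2l ?lee_fin// probability_le1.
have mMX i : measurable_fun A (M \o tail_path X i).
  by apply: measurable_funTS; exact: (measurableT_comp mM (measurable_path X i)).
have mind : measurable_fun A (fun w => (\1_(sample_path X @^-1` E) w)%:E : \bar R).
  by apply: measurable_funTS; exact/measurable_EFinP.
rewrite -(leeD2lE _ _ Ifin).
rewrite preimage_setI setIC -integral_indic//.
rewrite -ge0_integralZl//.
rewrite -ge0_integralD//; last 2 first.
- exact: (mMX 0%N).
- exact: emeasurable_funM.
apply: (@le_trans _ _ (\int[P]_(w in A) (1 + M (tail_path X 1 w))))%E.
  apply: ge0_le_integral => //.
  - by move=> w _; rewrite adde_ge0 ?mule_ge0 ?lee_fin.
  - by apply: emeasurable_funD; [exact: (mMX 0%N)|exact: emeasurable_funM].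
  - by apply: emeasurable_funD => //; exact: mMX.
  - move=> w _; rewrite /M -EFinM -!EFinD lee_fin indicE.
    have -> : (w \in sample_path X @^-1` E) =
        (0 < garsia_max u q n (sample_path X w))%N && (u < sample_path X w 0%N).
      by apply/idP/idP; rewrite inE.
    rewrite -natrM -natrD -[1]/(1%:R) -natrD ler_nat tail_pathS.
    exact: garsia_ineq.
rewrite ge0_integralD//; last exact: mMX.
rewrite integral_cst// mul1e addeC.
have -> : (\int[P]_(w in A) M (tail_path X 1 w) = I)%E.
  rewrite /I -(stationary_integral _ _ 1 (borel_rare u) mM M0).
  by rewrite rare_invariant.
by rewrite leeD2lE// probability_le1.
Qed.

(** On a rare path the partial sums of 1 - q * (u < x j) become positive for
    every [q]; letting [n] and then [q] tend to infinity in [maximal_rare]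
    leaves no mass. *)
Lemma exceed_rare_null (u : R) :
  P (sample_path X @^-1` (rare u `&` [set x | u < x 0%N])) = 0%E.
Proof.
pose F q n : set T := sample_path X @^-1`
  (rare u `&` [set x | (0 < garsia_max u q n x)%N && (u < x 0%N)]).
have mF q n : measurable (F q n).
  apply: (measurable_tail_path X 0); apply: (@measurableI _ (path_space R)).
    exact: borel_rare.
  apply: measurable_pred; apply: measurable_and.
    apply: (measurable_fun_ltn (f := cst 0%N)) => //.
    exact: measurable_garsia_max.
  exact: measurable_exceed.
have FE q : \bigcup_n F q n =
    sample_path X @^-1` (rare u `&` [set x | u < x 0%N]).
  apply/seteqP; split=> [w [n _ [rw /andP[_ uw]]]|w [rw uw]]; first by split.
  have [n] := rw q 0%N; rewrite addn0 => qn; exists n => //; split=> //.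
  apply/andP; split=> //; rewrite (leq_trans _ (leq_garsia_max u q n _ n _))//.
  by rewrite subn_gt0.
set p := P _.
have pq q : (q%:R%:E * p <= 1)%E.
  have ndF : nondecreasing_seq (F q).
    move=> m n mn; apply/subsetPset => w [rw /andP[Mw uw]]; split=> //.
    apply/andP; split=> //; apply: leq_trans Mw _.
    apply/bigmax_leqP => j _; apply: leq_garsia_max.
    by rewrite (leq_trans _ mn)// -ltnS.
  have := nondecreasing_cvg_mu (mu := P) (mF q) (bigcupT_measurable _ (mF q)) ndF.
  rewrite FE -/p => /(cvgeZl (y := q%:R%:E) erefl) /cvge_to_le; apply.
  by apply: nearW => n; exact: maximal_rare.
have pfin : p \is a fin_num
  by rewrite fin_num_measure// -(FE 0%N); exact: bigcupT_measurable.
apply/eqP; rewrite eq_le measure_ge0 andbT -/p -(fineK pfin) lee_fin leNgt.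
apply/negP => p0.
have := pq (Num.truncn (fine p)^-1).+1.
rewrite -(fineK pfin) -EFinM lee_fin leNgt => /negP; apply.
by rewrite -ltr_pdivrMr// mul1r truncnS_gt.
Qed.

(** * Comparison with the conditional right endpoint *)

(** The constant 1 is a version of the conditional probability of an almost sure
    event. *)
Lemma cond_prob_eq1_null {G : set (set T)} (A : set T) : sigma_algebra setT G ->
  G `<=` measurable -> measurable A -> P (~` A) = 0%E -> cond_prob_eq1 P G A.
Proof.
move=> [G0 GC GU] GT mA PA0; exists (cst 1); last exact: aeW.
have PCA C : G C -> P (A `&` C) = P C.
  move=> /GT mC; rewrite (measureDI P mC mA) setIC -[LHS]add0e; congr (_ + _)%E.
  apply/esym; apply: (subset_measure0 _ _ _ PA0).
  - exact: measurableD.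
  - exact: measurableC.
  - by move=> w [].
split.
- move=> B mB; rewrite preimage_cst; case: ifPn => // _.
  by have := GC _ G0; rewrite setD0.
- exact: finite_measure_integrable_cst.
- move=> C CG; rewrite PCA// -[RHS]mul1e.
  exact: (integral_cst P (GT _ CG) 1%:E).
Qed.

(** Truncating the trivial bound +oo to [u] on the rare paths still gives an
    invariant upper bound of the first observation. *)
Lemma not_rare_ae (gamma1 : T -> \bar R) (u : R) :
  is_cond_right_endpoint (invariant_sets X) (X 0%N) gamma1 ->
  {ae P, forall w, gamma1 w = +oo%E} ->
  {ae P, forall w, ~ rare u (sample_path X w)}.
Proof.
move=> [_ _ least] goo; set A := sample_path X @^-1` rare u.
have iA : invariant_sets X A := rare_invariant_sets u.
have sI := sigma_algebra_invariant_sets X.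
pose Q w : \bar R := if w \in A then u%:E else +oo%E.
have mQ : measurable_wrt (invariant_sets X) Q.
  have [i0 iC _] := sI => B mB.
  have iT : invariant_sets X setT by rewrite -(setD0 setT); exact: iC.
  have iCA : invariant_sets X (~` A) by rewrite -setTD; exact: iC.
  have [uB|uB] := pselect (B u%:E); have [ooB|ooB] := pselect (B +oo%E).
  - rewrite (_ : _ @^-1` _ = setT)//; apply/seteqP; split=> // w _.
    by rewrite /Q /=; case: ifP.
  - rewrite (_ : _ @^-1` _ = A)//; apply/seteqP; split=> w; rewrite /Q /=.
      by case: ifPn => //; rewrite inE.
    by move=> Aw; rewrite mem_set.
  - rewrite (_ : _ @^-1` _ = ~` A)//; apply/seteqP; split=> w; rewrite /Q /=.
      by case: ifPn => //; rewrite notin_setE.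
    by move=> Aw; rewrite memNset.
  - rewrite (_ : _ @^-1` _ = set0)//; apply/seteqP; split=> // w.
    by rewrite /Q /=; case: ifP.
pose E := sample_path X @^-1` (rare u `&` [set x | u < x 0%N]).
have mE : measurable E.
  apply: (measurable_tail_path X 0); apply: (@measurableI _ (path_space R)).
    exact: borel_rare.
  exact: (measurable_pred _ (measurable_exceed u 0)).
have XQ : [set w | ((X 0%N w)%:E <= Q w)%E] = ~` E.
  apply/seteqP; split=> w; rewrite /Q /E /=.
    by move=> + [rw uw]; rewrite mem_set// lee_fin leNgt uw.
  move=> nE; case: ifPn => [/set_mem rw|_]; last exact: leey.
  by rewrite lee_fin leNgt; apply/negP => uw; exact: nE.
have : {ae P, forall w, (gamma1 w <= Q w)%E}.
  apply: least => //; apply: cond_prob_eq1_null => //.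
  - exact: invariant_sets_measurable.
  - by rewrite XQ; exact: measurableC.
  - by rewrite XQ setCK; exact: exceed_rare_null.
apply: filterS2 goo => w -> + rw.
by rewrite /Q mem_set.
Qed.

End stationary.

Theorem theorem4p3 (d : measure_display) (T : measurableType d) (R : realType)
    (P : probability T R) (a : R) (a_gt0 : 0 < a)
    (k : nat -> nat) (k_range : forall n : nat, (1 <= n)%N -> (1 <= k n <= n)%N)
    (k_lim : (k n)%:R / n%:R @[n --> \oo] --> (1 : R))
    (X : nat -> {RV P >-> R}) (X_stat : strictly_stationary X)
    (gamma1 : T -> \bar R)
    (gamma1P : is_cond_right_endpoint (invariant_sets X) (X 0%N) gamma1)
    (gamma1_oo : {ae P, forall w, gamma1 w = +oo%E}) :
  {ae P, forall w, asymp_equiv \oo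
    (fun n => Ssum (sample_path X w) (k n) n a
              / order_stat (sample_path X w) (k n) n)
    (fun n => Kcount (sample_path X w) (k n) n a)}
  /\
  forall N : R -> T -> nat,
    (forall t, 0 <= t -> measurable_fun setT (N t)) ->
    {ae P, forall w, N t w @[t --> +oo] --> \oo} ->
    {ae P, forall w, asymp_equiv +oo
      (fun t => Ssum (sample_path X w) (k (N t w)) (N t w) a
                / order_stat (sample_path X w) (k (N t w)) (N t w))
      (fun t => Kcount (sample_path X w) (k (N t w)) (N t w) a)}.
Proof.
have window_ae : {ae P, forall w, asymp_equiv \oo
    (fun n => Ssum (sample_path X w) (k n) n a
              / order_stat (sample_path X w) (k n) n)
    (fun n => Kcount (sample_path X w) (k n) n a)}.
  have : {ae P, forall w, forall m : nat, ~ rare m%:R (sample_path X w)}.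
    by apply: ae_foralln => m; exact: (not_rare_ae X X_stat gamma1 m%:R).
  apply: filterS => w nrare; apply: asymp_equiv_window => //.
  exact: order_stat_cvg_pinfty.
split=> // N _ Noo; apply: filterS2 window_ae Noo => w eqv Nw.
exact: (asymp_equiv_comp \oo _ _ _ (N^~ w) Nw eqv).
Qed.
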